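(* Let $Y$ be a real vector space, $A\subseteq Y$ nonempty, $k\in Y\setminus\{0\}$, and let $D$ be a nonempty subset of $Y$. (1) If $\varphi_{A,k}(d)\not<0$ for all $d\in D$, then $\operatorname{core}A\cap D=\emptyset$. (2) If $A-\mathbb{R}_>\cdot k\subseteq\operatorname{core}A$, then: $\operatorname{core}A\cap D=\emptyset$ if and only if $\varphi_{A,k}(d)\not<0$ for all $d\in D$. (3) If $k\in-0^+A$ and $A$ is $k$-directionally closed, then: $A\cap D=\emptyset$ if and only if $\varphi_{A,k}(d)\not\le0$ for all $d\in D$.
   Context: For nonempty $A\subseteq Y$ and $k\in Y\setminus\{0\}$, $\varphi_{A,k}(y):=\inf\{t\in\mathbb{R}\mid y\in A+tk\}$ for $y\in Y$, where $\inf\emptyset:=\nu$ with $\nu$ a symbol not in $\mathbb{R}\cup\{-\infty,+\infty\}$, and the infimum is $-\infty$ if the set is unbounded below. $\nu$ is not comparable with real numbers, so $\varphi_{A,k}(d)\not<0$ (and $\not\le0$) holds in particular when $\varphi_{A,k}(d)=\nu$. $\mathbb{R}_>=(0,\infty)$. $0^+A:=\{u\in Y\mid\forall a\in A\ \forall t\in[0,\infty):\ a+tu\in A\}$. $\operatorname{core}A$ is the algebraic interior: $a\in\operatorname{core}A$ iff $a\in A$ and for each $v\in Y$ there is $\varepsilon>0$ with $a+sv\in A$ for all $s\in[0,\varepsilon]$. $A$ is $k$-directionally closed if for every $y\in Y$: whenever there is a sequence $(t_n)$ of positive reals decreasing to $0$ with $y-t_nk\in A$ for all $n$, then $y\in A$.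 *)

(* Defs.v *)
From HB Require Import structures.
From mathcomp Require Import all_boot all_order all_algebra.
From mathcomp Require Import all_classical all_reals all_analysis.

Set Implicit Arguments.
Unset Strict Implicit.
Unset Printing Implicit Defensive.

Import Order.TTheory GRing.Theory Num.Theory.
Import numFieldNormedType.Exports.

Local Open Scope classical_set_scope.
Local Open Scope ring_scope.

Definition shift_params (R : realType) (Y : lmodType R) (A : set Y) (k y : Y)
    : set R :=
  [set t | [set a + t *: k | a in A] y].

(* The symbol nu, the infimum of the empty set, is None: it is distinct from
   every extended real number, +oo included. *)
Definition phi (R : realType) (Y : lmodType R) (A : set Y) (k y : Y)
    : option (\bar R) :=
  if `[< shift_params A k y = set0 >] then None
  else Some (ereal_inf [set t%:E | t in shift_params A k y]).

(* nu is comparable with no number, so both relations are false at None. *)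
Definition lt_nu (R : realType) (x : option (\bar R)) (y : \bar R) : bool :=
  if x is Some r then (r < y)%E else false.

Definition le_nu (R : realType) (x : option (\bar R)) (y : \bar R) : bool :=
  if x is Some r then (r <= y)%E else false.

Definition recession_cone (R : realType) (Y : lmodType R) (A : set Y)
    : set Y :=
  [set u | forall a, A a -> forall t : R, 0 <= t -> A (a + t *: u)].

Definition alg_core (R : realType) (Y : lmodType R) (A : set Y) : set Y :=
  [set a | A a /\ forall v : Y, exists2 e : R, 0 < e &
     forall s : R, 0 <= s <= e -> A (a + s *: v)].

Definition directionally_closed (R : realType) (Y : lmodType R) (k : Y)
    (A : set Y) : Prop :=
  forall y : Y,
    (exists t : R^nat, [/\ forall n, 0 < t n, decreasing_seq t,
       t n @[n --> \oo] --> 0 & forall n, A (y - t n *: k)]) ->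
    A y.

(* Main.v *)
Require Import Defs.
From HB Require Import structures.
From mathcomp Require Import all_boot all_order all_algebra.
From mathcomp Require Import all_classical all_reals all_analysis.

Import Order.TTheory GRing.Theory Num.Theory.
Import numFieldNormedType.Exports.

Local Open Scope classical_set_scope.
Local Open Scope ring_scope.

(** Everything rests on reading the sublevel sets of [phi A k] off the line
    through [y] in direction [k].  Since [y \in A + t k] means [y - t k \in A],
    the strict sublevel condition [phi A k y < c] says that [y - t k] lies in
    [A] for some [t < c] ([lt_nu_phiP]), and [phi A k y <= c] says that such
    [t] exist below every number larger than [c] ([le_nu_phiP]).  The value nu
    causes no trouble: it occurs exactly when no [t] at all is available, and
    then both sides fail.

    Geometric remarks then give the three parts, each by contraposition.
    A point [d] of the algebraic interior can be moved a little along [k]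
    without leaving [A], which provides a negative [t].  Conversely, a negative
    [t] exhibits [d] as an element of [A - R_> k].  Finally, if [- k] is a
    recession direction, the set of [t] with [d - t k \in A] is upward closed;
    when its infimum is at most [0] it contains all the numbers [1 / (n + 1)],
    and directional closedness puts [d] itself in [A], while [t = 0] witnesses the
    reverse implication. *)

Section ScalarizationSublevels.
Context {R : realType} {Y : lmodType R}.
Implicit Types (A D : set Y) (k y : Y) (c t : R).

Lemma shift_paramsP A k y t : shift_params A k y t <-> A (y - t *: k).
Proof.
split=> [[a Aa <-]|Ay]; first by rewrite addrK.
by exists (y - t *: k) => //; rewrite subrK.
Qed.

Lemma lt_nu_phiP A k y c :
  lt_nu (phi A k y) c%:E <-> exists2 t, t < c & A (y - t *: k).
Proof.
rewrite /phi; case: asboolP => [no_t|_] /=; split=> //.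
- by case=> t _ /shift_paramsP; rewrite no_t.
- by case/ereal_inf_lt=> _ [t /shift_paramsP Ay <-]; rewrite lte_fin; exists t.
- case=> t tc /shift_paramsP Ay.
  by apply: (@le_lt_trans _ _ t%:E) => //; apply: ereal_inf_lbound; exists t.
Qed.

(** The infimum need not be attained, hence the slack on the right; it also
    hides the distinction between a finite infimum and [-oo]. *)
Lemma le_nu_phiP A k y c :
  le_nu (phi A k y) c%:E <->
  forall e : R, 0 < e -> exists2 t, t < c + e & A (y - t *: k).
Proof.
have slack : le_nu (phi A k y) c%:E <->
    forall e : R, 0 < e -> lt_nu (phi A k y) (c + e)%:E.
  case: (phi A k y) => [r|] /=; last by split=> // /(_ 1 ltr01).
  split=> [rc e e0|rc].
    by apply: le_lt_trans rc _; rewrite lte_fin ltrDl.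
  by apply/lee_addgt0Pr => e e0; rewrite -EFinD; apply/ltW/rc.
by rewrite slack; split=> H e e0; apply/lt_nu_phiP/H.
Qed.

Lemma alg_core_lt0_phi A k y : alg_core A y -> lt_nu (phi A k y) 0%E.
Proof.
case=> _ /(_ k) [e e0 Ae]; apply/lt_nu_phiP; exists (- e).
  by rewrite oppr_lt0.
by rewrite scaleNr opprK; apply: Ae; rewrite ltW //= lexx.
Qed.

Lemma lt0_phi_translate A k y : lt_nu (phi A k y) 0%E ->
  [set a - t *: k | a in A & t in [set t : R | 0 < t]] y.
Proof.
case/lt_nu_phiP=> t t0 Ay; exists (y - t *: k) => //.
by exists (- t); rewrite /= ?oppr_gt0 // scaleNr opprK subrK.
Qed.

Lemma mem_le0_phi A k y : A y -> le_nu (phi A k y) 0%E.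
Proof.
move=> Ay; apply/le_nu_phiP => e e0; exists 0; first by rewrite add0r.
by rewrite scale0r subr0.
Qed.

Lemma recession_opp_shift A k y t s :
  recession_cone A (- k) -> t <= s -> A (y - t *: k) -> A (y - s *: k).
Proof.
move=> rec ts /rec /(_ (s - t)); rewrite subr_ge0 => /(_ ts).
by rewrite scalerN scalerBl opprB addrA subrK.
Qed.

(** The definition of directional closedness asks for one strictly decreasing
    null sequence; upward closedness lets any such sequence serve. *)
Lemma le0_phi_mem A k y :
  recession_cone A (- k) -> directionally_closed k A ->
  le_nu (phi A k y) 0%E -> A y.
Proof.
move=> rec closedA /le_nu_phiP phi_le0; apply: closedA.
exists (@harmonic R); split=> [n|m n||n].
- exact: harmonic_gt0.
- by rewrite /= lef_pV2 ?posrE ?ltr0n // ler_nat.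
- exact: cvg_harmonic.
- have [t] := phi_le0 _ (harmonic_gt0 n).
  by rewrite add0r => /ltW; apply: recession_opp_shift.
Qed.

Lemma disjoint_iff A D (P : Y -> Prop) :
  (forall y, A y <-> P y) -> A `&` D = set0 <-> forall d, D d -> ~ P d.
Proof.
move=> AP; split=> [AD0 d Dd /AP Ad|nP].
  by have : (A `&` D) d by []; rewrite AD0.
by rewrite -subset0 => d [/AP Pd /nP].
Qed.

End ScalarizationSublevels.

Theorem proposition5 (R : realType) (Y : lmodType R) (A : set Y) (k : Y)
    (D : set Y) (A0 : A !=set0) (k0 : k != 0) (D0 : D !=set0) :
  [/\ (forall d, D d -> ~ lt_nu (phi A k d) 0%E) ->
        alg_core A `&` D = set0,
      [set a - t *: k | a in A & t in [set t : R | 0 < t]] `<=` alg_core A ->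
        (alg_core A `&` D = set0 <->
         forall d, D d -> ~ lt_nu (phi A k d) 0%E) &
      [set - u | u in recession_cone A] k -> directionally_closed k A ->
        (A `&` D = set0 <->
         forall d, D d -> ~ le_nu (phi A k d) 0%E)].
Proof.
split=> [phi_nlt0|sub_core|[u rec <-] closedA].
- by rewrite -subset0 => d [/(alg_core_lt0_phi _ k) lt0 /phi_nlt0].
- apply: disjoint_iff => d; split; first exact: alg_core_lt0_phi.
  by move=> /lt0_phi_translate /sub_core.
- apply: disjoint_iff => d; split; first exact: mem_le0_phi.
  by apply: le0_phi_mem; rewrite ?opprK.
Qed.
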